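(* Let $\Omega$ and $\Lambda$ be non-empty sets, $v\colon\Lambda\to(0,\infty)$, $(E,\|\cdot\|_E)$ a normed space over $\mathbb{K}$, $\mathcal{G}(\Omega,E)$ a linear subspace of $E^\Omega$, $q^E\colon\mathcal{G}(\Omega,E)\to[0,\infty)$ a seminorm, $T^E\colon\mathcal{G}(\Omega,E)\to E^\Lambda$ a linear map, and \[ \mathcal{F}v(\Omega,E):=\Bigl\{f\in\mathcal{G}(\Omega,E):\|f\|^E:=q^E(f)+\sup_{x\in\Lambda}\|T^E(f)(x)\|_Ev(x)<\infty\Bigr\}. \] Suppose that $(\mathcal{F}v(\Omega,E),\|\cdot\|^E)$ is normed (i.e. $\|\cdot\|^E$ is a norm), that $q^E=\|T_0^E(\cdot)\|_E$ for some linear map $T_0^E\colon\mathcal{G}(\Omega,E)\to E$, and let $f'\colon\mathcal{F}v(\Omega,E)\to\mathbb{K}$. Then $f'\in(\mathcal{F}v(\Omega,E),\gamma_{\mathrm{s}}(\|\cdot\|^E,\tau_{\mathcal{N}_\Lambda}^E))'$ if and only if there are $(\lambda_n)_{n\in\mathbb{N}}\in\ell^1(\mathbb{N},(E\oplus_1E)^* )$ and a sequence $(x_n)_{n\in\mathbb{N}}$ in $\Lambda$ such that \[ f'(f)=\sum_{n=1}^\infty\lambda_n\bigl(T_0^E(f),T^E(f)(x_n)v(x_n)\bigr),\quad f\in\mathcal{F}v(\Omega,E). \]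
   Context: $\mathbb{K}\in\{\mathbb{R},\mathbb{C}\}$; $(Y,\tau)'$ denotes the space of continuous linear functionals on $(Y,\tau)$; $E^\Lambda$ is the space of all functions $\Lambda\to E$; suprema of non-negative quantities over the empty set are $0$. $E\oplus_1E$ is $E\times E$ with norm $\|(x,y)\|_{E\oplus_1E}:=\|x\|_E+\|y\|_E$, and $(E\oplus_1E)^*$ is its norm dual. $\ell^1(\mathbb{N},(E\oplus_1E)^* )$ is the space of sequences $y=(y_n)_{n\in\mathbb{N}}$ in $(E\oplus_1E)^*$ with $\sum_{n=1}^\infty\|y_n\|_{(E\oplus_1E)^*}<\infty$. $\mathcal{N}_\Lambda$ is the family of finite subsets of $\Lambda$, and $\tau_{\mathcal{N}_\Lambda}^E$ is the locally convex Hausdorff topology on $\mathcal{F}v(\Omega,E)$ generated by the directed system of seminorms $q_S^E(f):=q^E(f)+\sup_{x\in S}\|T^E(f)(x)\|_Ev(x)$, $S\in\mathcal{N}_\Lambda$. One has $\|f\|^E=\sup_{S\in\mathcal{N}_\Lambda}q_S^E(f)$. The submixed topology $\gamma_{\mathrm{s}}(\|\cdot\|^E,\tau_{\mathcal{N}_\Lambda}^E)$ is the locally convex Hausdorff topology on $\mathcal{F}v(\Omega,E)$ generated by the seminorms $f\mapsto\sup_{n\in\mathbb{N}}q_{S_n}^E(f)a_n$, where $(S_n)_{n\in\mathbb{N}}$ is a sequence in $\mathcal{N}_\Lambda$ and $(a_n)_{n\in\mathbb{N}}$ is a real non-negative null-sequence. *)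

(* Defs.v *)
From HB Require Import structures.
From mathcomp Require Import all_boot all_order all_algebra.
From mathcomp Require Import all_classical all_reals all_analysis.
From mathcomp Require Import complex.

Set Implicit Arguments.
Unset Strict Implicit.
Unset Printing Implicit Defensive.

Import Order.TTheory GRing.Theory Num.Theory.
Import numFieldTopology.Exports numFieldNormedType.Exports.

Local Open Scope classical_set_scope.
Local Open Scope ring_scope.

Variant scalar_kind := RealScalars | ComplexScalars.

Definition scalars (R : realType) (k : scalar_kind) : numFieldType :=
  match k with RealScalars => R | ComplexScalars => R[i] end.

Definition toR (R : realType) (k : scalar_kind) : scalars R k -> R :=
  match k return scalars R k -> R with
  | RealScalars => fun x => x
  | ComplexScalars => fun z => complex.Re z
  end.

Definition ofR (R : realType) (k : scalar_kind) : R -> scalars R k :=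
  match k return R -> scalars R k with
  | RealScalars => fun x => x
  | ComplexScalars => fun x => Complex x 0
  end.

Arguments toR {R k}.
Arguments ofR {R} k.

(* The norm of a [normedZmodType K] is [K]-valued; for [K = R[i]] its values *)
(* have zero imaginary part, so [toR] loses nothing.                         *)
Definition rnorm (R : realType) (k : scalar_kind)
  (X : normedZmodType (scalars R k)) (x : X) : R := toR `|x|.

Section RealNorm.
Context {R : realType} {k : scalar_kind}.
Notation K := (scalars R k).

Lemma toR_le (x y : K) : x <= y -> toR x <= toR y.
Proof. by case: k x y => x y //=; rewrite lecE => /andP[]. Qed.

Lemma toRD (x y : K) : toR (x + y) = toR x + toR y.
Proof. by case: k x y => // -[? ?] [? ?]. Qed.

Lemma toR0 : toR (0 : K) = 0.
Proof. by case: k. Qed.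

Lemma rnorm_ge0 (X : normedZmodType K) (x : X) : 0 <= rnorm x.
Proof. by rewrite /rnorm -toR0 toR_le. Qed.

Lemma ler_rnormD (X : normedZmodType K) (x y : X) :
  rnorm (x + y) <= rnorm x + rnorm y.
Proof. by rewrite /rnorm -toRD toR_le// ler_normD. Qed.

Lemma rnormZ (X : normedModType K) (a : K) (x : X) :
  rnorm (a *: x) = rnorm a * rnorm x.
Proof.
rewrite /rnorm normrZ; move: (normr_ge0 a) (normr_ge0 x).
move: `|a| `|x| => {a x} a x; case: k a x => //= -[a b] [c d] /=.
by rewrite !lecE /= => /andP[/eqP-> _] /andP[/eqP-> _]; rewrite mulr0 subr0.
Qed.

End RealNorm.

Definition is_seminorm (R : realType) (k : scalar_kind)
    (V : lmodType (scalars R k)) (p : V -> R) : Prop :=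
  [/\ forall x, 0 <= p x,
      forall x y, p (x + y) <= p x + p y &
      forall (a : scalars R k) x, p (a *: x) = rnorm a * p x].

Definition is_norm (R : realType) (k : scalar_kind)
    (V : lmodType (scalars R k)) (p : V -> R) : Prop :=
  is_seminorm p /\ forall x, p x = 0 -> x = 0.

Record seminorm (R : realType) (k : scalar_kind)
    (V : lmodType (scalars R k)) := Seminorm {
  seminorm_fun :> V -> R ;
  seminormP : is_seminorm seminorm_fun }.

Definition submod (K : numFieldType) (V : lmodType K) (S : submodClosed V) :=
  {x : V | x \in S}.

HB.instance Definition _ (K : numFieldType) (V : lmodType K)
  (S : submodClosed V) := SubChoice.on (submod S).
HB.instance Definition _ (K : numFieldType) (V : lmodType K)
  (S : submodClosed V) := [SubChoice_isSubLmodule of submod S by <:].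

(* [V] with the topology generated by the seminorms in [P], i.e. the         *)
(* coarsest one for which all balls [set y | p (y - x) < e] are open.        *)
Definition seminormed_top (R : realType) (k : scalar_kind)
  (V : lmodType (scalars R k)) (P : set (V -> R)) : Type := V.

Definition seminorm_balls (R : realType) (k : scalar_kind)
    (V : lmodType (scalars R k)) (P : set (V -> R)) : set (set V) :=
  [set B | exists p x (e : R),
     [/\ P p, 0 < e & B = [set y | p (y - x) < e]]].

HB.instance Definition _ (R : realType) (k : scalar_kind)
  (V : lmodType (scalars R k)) (P : set (V -> R)) :=
  GRing.Lmodule.on (seminormed_top P).
HB.instance Definition _ (R : realType) (k : scalar_kind)
  (V : lmodType (scalars R k)) (P : set (V -> R)) :=
  isSubBaseTopological.Build (seminormed_top P) (seminorm_balls P) id.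

Definition top_dual (K : numFieldType) (V : preTopologicalLmodType K) :
    set (V -> K) :=
  [set u : V -> K | scalar u /\ continuous u].

Definition l1_prod (E F : Type) : Type := (E * F)%type.

Section L1Prod.
Context {K : numFieldType} {E F : normedModType K}.

HB.instance Definition _ := GRing.Lmodule.copy (l1_prod E F) (E * F)%type.

Definition l1_prod_norm (z : l1_prod E F) : K := `|z.1| + `|z.2|.

Lemma l1_prod_normD (x y : l1_prod E F) :
  l1_prod_norm (x + y) <= l1_prod_norm x + l1_prod_norm y.
Proof. by rewrite /l1_prod_norm addrACA lerD// ler_normD. Qed.

Lemma l1_prod_normZ (a : K) (x : l1_prod E F) :
  l1_prod_norm (a *: x) = `|a| * l1_prod_norm x.
Proof. by rewrite /l1_prod_norm !normrZ mulrDr. Qed.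

Lemma l1_prod_norm0_eq0 (x : l1_prod E F) : l1_prod_norm x = 0 -> x = 0.
Proof.
case: x => x y /eqP; rewrite /l1_prod_norm paddr_eq0//= !normr_eq0.
by move=> /andP[/eqP-> /eqP->].
Qed.

HB.instance Definition _ := @Lmodule_isNormed.Build K (l1_prod E F)
  l1_prod_norm l1_prod_normD l1_prod_normZ l1_prod_norm0_eq0.

End L1Prod.

Definition dual_norm (R : realType) (k : scalar_kind)
    (X : normedModType (scalars R k)) (u : X -> scalars R k) : \bar R :=
  ereal_sup [set (rnorm (u x))%:E | x in [set x : X | rnorm x <= 1]].

Definition ell1_dual (R : realType) (k : scalar_kind)
    (X : normedModType (scalars R k)) : set (nat -> X -> scalars R k) :=
  [set u | (forall n, top_dual (u n)) /\
           (\sum_(0 <= n <oo) dual_norm (u n) < +oo)%E].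

Section WeightedSpace.
Context {R : realType} {k : scalar_kind}.
Notation K := (scalars R k).
Context {Omega Lambda : Type} (v : Lambda -> {posnum R}).
Context {E : normedModType K} {G : submodClosed (Omega -> E)}.
Context (q : seminorm (submod G)) (T : {linear submod G -> (Lambda -> E)}).

(* [q f + sup_(x in S) |T f x| v x], possibly infinite; adjoining 0 to the   *)
(* set makes the supremum over the empty set equal to 0.                     *)
Definition ext_seminorm (S : set Lambda) (f : submod G) : \bar R :=
  ((q f)%:E + ereal_sup
     (0 |` [set (rnorm (T f x) * (v x)%:num)%:E | x in S]))%E.

Definition Fv_pred : {pred submod G} :=
  [pred f | `[< (ext_seminorm setT f < +oo)%E >]].

Lemma ext_seminorm_ltyP S f : (ext_seminorm S f < +oo)%E <->
  exists M : R, forall x, S x -> rnorm (T f x) * (v x)%:num <= M.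
Proof.
rewrite /ext_seminorm; set A := (0 |` _)%classic; split.
- move=> h.
  have : (ereal_sup A < +oo)%E.
    by move: h; case: (ereal_sup A) => [r| |]; rewrite ?ltry ?ltNyr ?addey ?ltxx.
  have : (0 <= ereal_sup A)%E by apply: ereal_sup_ubound; left.
  have ub y : A y -> (y <= ereal_sup A)%E by move=> Ay; apply: ereal_sup_ubound.
  move: ub; case: (ereal_sup A) => [r| |]// ub _ _; exists r => x Sx.
  by rewrite -lee_fin; apply: ub; right; exists x.
- move=> [M hM].
  have : (ereal_sup A <= (Num.max 0 M)%:E)%E.
    apply: ge_ereal_sup => _ [->|[x Sx <-]].
      by rewrite lee_fin le_max lexx.
    by rewrite lee_fin le_max hM ?orbT.
  by case: (ereal_sup A) => [r| |]//= _; rewrite ?ltNyr ?ltry.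
Qed.

Lemma Fv_predP f : f \in Fv_pred <->
  exists M : R, forall x, rnorm (T f x) * (v x)%:num <= M.
Proof.
split=> [/asboolP/ext_seminorm_ltyP[M hM]|[M hM]].
  by exists M => x; apply: hM.
by apply/asboolP; apply/ext_seminorm_ltyP; exists M.
Qed.

Lemma Fv_pred_closed : subsemimod_closed Fv_pred.
Proof.
apply: GRing.submod_closed_semi; split.
  apply/Fv_predP; exists 0 => x.
  by rewrite linear0 /rnorm normr0 toR0 mul0r.
move=> a f g /Fv_predP[M hM] /Fv_predP[N hN]; apply/Fv_predP.
exists (rnorm a * M + N) => x.
rewrite linearP; apply: (@le_trans _ _
  ((rnorm a * rnorm (T f x) + rnorm (T g x)) * (v x)%:num)).
  by rewrite ler_wpM2r// -rnormZ ler_rnormD.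
by rewrite mulrDl -mulrA lerD ?hN// ler_wpM2l ?rnorm_ge0// hM.
Qed.

HB.instance Definition _ :=
  GRing.isSubSemiModClosed.Build K (submod G) Fv_pred Fv_pred_closed.

Definition Fv := submod Fv_pred.

Definition qS (S : set Lambda) (f : Fv) : R := fine (ext_seminorm S (val f)).

Definition Fv_norm (f : Fv) : R := qS setT f.

Definition submixed_seminorms : set (Fv -> R) :=
  [set p | exists (S : nat -> set Lambda) (a : nat -> R),
     [/\ forall n, finite_set (S n), forall n, 0 <= a n, a @ \oo --> (0 : R) &
         p = fun f => sup (range (fun n => qS (S n) f * a n))]].

Definition submixed_Fv : preTopologicalLmodType K :=
  seminormed_top submixed_seminorms.

End WeightedSpace.

Arguments ext_seminorm {R k Omega Lambda} v {E G} q T S f.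
Arguments qS {R k Omega Lambda} v {E G} q T S f.
Arguments Fv_norm {R k Omega Lambda} v {E G} q T f.
Arguments Fv {R k Omega Lambda} v {E G} q T.
Arguments submixed_seminorms {R k Omega Lambda} v {E G} q T.
Arguments submixed_Fv {R k Omega Lambda} v {E G} q T.

(* Main.v *)
(* An element of the dual is dominated by one seminorm                       *)
(* [f |-> sup_n q_(S n) f * a n]: the family of these seminorms is directed   *)
(* ([S n `|` S' n] and [a n + a' n]).  Listing the points of all the [S n] as *)
(* [x j], with weight [b j = a n], this seminorm is at most the sup norm of   *)
(* the null sequence [Phi f j = b j (T0 f, T f (x j) v (x j))], so that by    *)
(* Hahn-Banach the functional extends from [range Phi] to all bounded         *)
(* sequences; restricted to the single coordinates the extension is an l1     *)
(* sequence of functionals, and its values at null sequences are the sums of  *)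
(* the coordinate values.  Conversely, a summable sequence [w] of dual norms  *)
(* factors as [w <= c a] with [c] summable and [a] null, and the series is    *)
(* bounded by [sum c] times the submixed seminorm of [{x n}] and [a].         *)

Require Import Defs.
From HB Require Import structures.
From mathcomp Require Import all_boot all_order all_algebra.
From mathcomp Require Import all_classical all_reals all_analysis.
From mathcomp Require Import complex ring lra.

Set Implicit Arguments.
Unset Strict Implicit.
Unset Printing Implicit Defensive.

Import Order.TTheory GRing.Theory Num.Theory.
Import numFieldTopology.Exports numFieldNormedType.Exports.

Local Open Scope classical_set_scope.
Local Open Scope ring_scope.

(** * The Hahn-Banach theorem *)

Section RealHahnBanach.
Context {R : realType} {V : lmodType R}.
Implicit Types (p : V -> R) (x y : V).

Definition sublinear p :=
  (forall x y, p (x + y) <= p x + p y) /\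
  (forall t x, 0 <= t -> p (t *: x) <= t * p x).

Lemma sublinear0 p : sublinear p -> p 0 = 0.
Proof.
move=> [pD pZ]; apply/eqP; rewrite eq_le; apply/andP; split.
  by have := pZ 0 0 (lexx 0); rewrite scale0r mul0r.
by have := pD 0 0; rewrite addr0 lerDl.
Qed.

Lemma sublinear_opp_le p x : sublinear p -> - p (- x) <= p x.
Proof.
move=> sp; have [pD _] := sp.
by have := pD x (- x); rewrite subrr sublinear0// addrC -lerBlDl sub0r.
Qed.

Lemma sublinearZ p t x : sublinear p -> 0 <= t -> p (t *: x) = t * p x.
Proof.
move=> sp; rewrite le_eqVlt => /predU1P[<-|t0].
  by rewrite scale0r mul0r sublinear0.
have [_ pZ] := sp; apply/eqP; rewrite eq_le; apply/andP; split;
  first by rewrite pZ// ltW.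
rewrite -ler_pdivlMl//; apply: le_trans (pZ _ _ _);
  last by rewrite invr_ge0 ltW.
by rewrite scalerA mulVf ?gt_eqF// scale1r.
Qed.

(* Lowers [p] so that it is at most [c] at [d] for each [(d, c)] in the cone. *)
Lemma sublinear_inf_cone p (C : V -> R -> Prop) :
    sublinear p -> C 0 0 ->
    (forall d c d' c', C d c -> C d' c' -> C (d + d') (c + c')) ->
    (forall t d c, 0 <= t -> C d c -> C (t *: d) (t * c)) ->
    (forall d c, C d c -> - c <= p (- d)) ->
  exists2 h, sublinear h & forall x d c, C d c -> h x <= p (x - d) + c.
Proof.
move=> sp C0 CD CZ Cp; have [pD pZ] := sp.
pose S x := [set p (x - dc.1) + dc.2 | dc in [set dc | C dc.1 dc.2]].
have Slb x : lbound (S x) (- p (- x)).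
  move=> _ [[d c] /= Cdc <-].
  have := pD (- x) (x - d); rewrite addrA addNr sub0r.
  by have := Cp _ _ Cdc; lra.
have S0 x : S x !=set0 by exists (p (x - 0) + 0); exists (0, 0).
have hle x d c : C d c -> inf (S x) <= p (x - d) + c.
  by move=> Cdc; apply: ge_inf; [exists (- p (- x))|exists (d, c)].
exists (fun x => inf (S x)) => //; split=> [x y|t x].
  rewrite -lerBlDr; apply: lb_le_inf => // _ [[d c] /= Cdc <-].
  rewrite lerBlDr -lerBlDl; apply: lb_le_inf => // _ [[d' c'] /= Cdc' <-].
  rewrite lerBlDl; apply: le_trans (hle _ _ _ (CD _ _ _ _ Cdc Cdc')) _.
  by rewrite opprD addrACA [leRHS]addrACA lerD2r.
rewrite le_eqVlt => /predU1P[<-|t0].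
  rewrite scale0r mul0r; apply: le_trans (hle _ _ _ C0) _.
  by rewrite subr0 addr0 sublinear0.
rewrite -ler_pdivrMl//; apply: lb_le_inf => // _ [[d c] /= Cdc <-].
rewrite ler_pdivrMl// mulrDr;
  apply: le_trans (hle _ _ _ (CZ _ _ _ (ltW t0) Cdc)) _.
by rewrite -scalerBr lerD2r pZ// ltW.
Qed.

Lemma minimal_sublinear p : sublinear p ->
  exists2 h, sublinear h /\ (forall x, h x <= p x) &
    forall g, sublinear g -> (forall x, g x <= h x) -> g = h.
Proof.
move=> sp; pose T := {h | sublinear h /\ forall x, h x <= p x}.
pose le (s t : T) := `[< forall x, sval t x <= sval s x >].
have [|||A totA|[h [sh hp]] hmin] := @Zorn T le.
- by move=> t; apply/asboolP.
- move=> r s t /asboolP rs /asboolP st; apply/asboolP => x.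
  exact: le_trans (st x) (rs x).
- move=> [s ?] [t ?] /asboolP /= ts /asboolP /= st; apply: eq_exist.
  by apply/funext => x; apply/eqP; rewrite eq_le ts st.
- have [->|/set0P A0] := eqVneq A set0.
    by exists (exist _ p (conj sp (fun x => lexx (p x)))).
  pose S x := [set sval h x | h in A].
  have S0 x : S x !=set0 by case: A0 => h Ah; exists (sval h x); exists h.
  have Slb x : lbound (S x) (- p (- x)).
    move=> _ [[h [sh hp]] /= _ <-]; apply: le_trans (sublinear_opp_le _ sh).
    by rewrite lerN2.
  have Sle x h : A h -> inf (S x) <= sval h x.
    by move=> Ah; apply: ge_inf; [exists (- p (- x))|exists h].
  have sS : sublinear (fun x => inf (S x)).
    split=> [x y|t x t0].
      rewrite -lerBlDr; apply: lb_le_inf => // _ [h Ah <-].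
      rewrite lerBlDr -lerBlDl; apply: lb_le_inf => // _ [g Ag <-].
      rewrite lerBlDl; have [/asboolP gh|/asboolP hg] := totA _ _ Ah Ag.
        apply: le_trans (Sle _ _ Ag) _; have [[gD _] _] := svalP g.
        by apply: le_trans (gD _ _) _; rewrite lerD2r.
      apply: le_trans (Sle _ _ Ah) _; have [[hD _] _] := svalP h.
      by apply: le_trans (hD _ _) _; rewrite lerD2l.
    move: t0; rewrite le_eqVlt => /predU1P[<-|t0].
      case: A0 => h Ah; rewrite scale0r mul0r.
      apply: le_trans (Sle _ _ Ah) _; have [sh _] := svalP h.
      by rewrite sublinear0.
    rewrite -ler_pdivrMl//; apply: lb_le_inf => // _ [h Ah <-].
    rewrite ler_pdivrMl//; apply: le_trans (Sle _ _ Ah) _.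
    by have [[_ hZ] _] := svalP h; rewrite hZ// ltW.
  have Sp x : inf (S x) <= p x.
    case: A0 => h Ah; apply: le_trans (Sle _ _ Ah) _.
    by have [_ ->] := svalP h.
  exists (exist (fun h => sublinear h /\ forall x, h x <= p x) _ (conj sS Sp)).
  by move=> h Ah; apply/asboolP => x; exact: Sle.
exists h => // g sg gh.
have gp x : g x <= p x by exact: le_trans (gh x) (hp x).
pose g' : T := exist (fun h => sublinear h /\ forall x, h x <= p x) g (conj sg gp).
have gh' : le (exist _ h (conj sh hp)) g' by apply/asboolP.
by have /(congr1 sval) := hmin g' gh'.
Qed.

(* Applied to the cone spanned by [(- y, - h y)], [sublinear_inf_cone] gives  *)
(* [g <= h] with [g x <= h (x + y) - h y]; minimality turns [g] into [h],    *)
(* so that [h] is superadditive.                                             *)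
Lemma minimal_sublinear_scalar (h : V -> R) : sublinear h ->
  (forall g, sublinear g -> (forall x, g x <= h x) -> g = h) -> scalar h.
Proof.
move=> sh hmin; have [hD hZ] := sh.
have h_add x y : h (x + y) = h x + h y.
  pose C d c := exists2 t, 0 <= t & d = - (t *: y) /\ c = - (t * h y).
  have [|||||g sg gle] := @sublinear_inf_cone h C.
  - exact: sh.
  - by exists 0 => //; rewrite scale0r mul0r !oppr0.
  - move=> _ _ _ _ [s s0 [-> ->]] [t t0 [-> ->]].
    by exists (s + t); rewrite ?addr_ge0// scalerDl mulrDl !opprD.
  - move=> s _ _ s0 [t t0 [-> ->]]; exists (s * t); rewrite ?mulr_ge0//.
    by rewrite scalerN mulrN scalerA mulrA.
  - by move=> _ _ [t t0 [-> ->]]; rewrite !opprK sublinearZ.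
  have gh : g = h.
    apply: hmin => // z; have := gle z 0 0; rewrite subr0 addr0; apply.
    by exists 0 => //; rewrite scale0r mul0r !oppr0.
  apply/eqP; rewrite eq_le hD/=.
  have := gle x (- y) (- h y); rewrite gh opprK lerBrDr; apply.
  by exists 1 => //; rewrite scale1r mul1r.
have hN x : h (- x) = - h x.
  by apply/eqP; rewrite -addr_eq0 addrC -h_add subrr sublinear0.
move=> a x y; rewrite h_add; congr (_ + _).
have [a0|/ltW a0] := leP 0 a; first by rewrite sublinearZ.
by rewrite -[a]opprK scaleNr hN sublinearZ ?oppr_ge0// !mulNr opprK.
Qed.

Lemma real_hahn_banach (U : lmodType R) (Phi : U -> V) (g : U -> R) p :
    sublinear p -> linear Phi -> scalar g ->
    (forall u, g u <= p (Phi u)) ->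
  exists h, [/\ scalar h, forall x, h x <= p x & forall u, h (Phi u) = g u].
Proof.
move=> sp lPhi lg gp.
have Phi0 : Phi 0 = 0.
  by have := lPhi (-1) 0 0; rewrite scaler0 addr0 scaleN1r addNr.
have g0 : g 0 = 0 by have := lg (-1) 0 0; rewrite scaler0 addr0 mulN1r addNr.
have PhiN u : Phi (- u) = - Phi u.
  by have := lPhi (-1) u 0; rewrite addr0 !scaleN1r Phi0 addr0.
have gN u : g (- u) = - g u.
  by have := lg (-1) u 0; rewrite addr0 scaleN1r mulN1r g0 addr0.
pose C d c := exists2 u, d = Phi u & c = g u.
have [|||||p' sp' p'le] := @sublinear_inf_cone p C.
- exact: sp.
- by exists 0.
- move=> _ _ _ _ [u -> ->] [u' -> ->]; exists (u + u').
    by have := lPhi 1 u u'; rewrite !scale1r.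
  by have := lg 1 u u'; rewrite scale1r mul1r.
- move=> t _ _ _ [u -> ->]; exists (t *: u).
    by have := lPhi t u 0; rewrite Phi0 !addr0.
  by have := lg t u 0; rewrite g0 !addr0.
- by move=> _ _ [u -> ->]; rewrite -gN -PhiN.
have [h [sh hp'] /(minimal_sublinear_scalar sh) lh] := minimal_sublinear sp'.
have hg u : h (Phi u) <= g u.
  apply: le_trans (hp' _) _;
    apply: le_trans (p'le _ _ _ (ex_intro2 _ _ u _ _)) _.
  - reflexivity.
  - reflexivity.
  by rewrite subrr sublinear0// add0r.
have hN x : h (- x) = - h x.
  by have := lh (-1) x 0; rewrite addr0 scaleN1r mulN1r sublinear0// addr0.
exists h; split=> // [x|u].
  apply: le_trans (hp' _) _; have := p'le x 0 0.
  by rewrite subr0 addr0; apply; exists 0.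
by apply/eqP; rewrite eq_le hg /= -lerN2 -hN -gN -PhiN hg.
Qed.

End RealHahnBanach.

Section Scalars.
Context {R : realType} {k : scalar_kind}.
Notation K := (scalars R k).
Implicit Types (r s : R) (a b : K).

Lemma toR_ofR r : toR (ofR k r : K) = r.
Proof. by case: k. Qed.

Lemma ofR0 : ofR k 0 = 0 :> K.
Proof. by case: k. Qed.

Lemma ofR1 : ofR k 1 = 1 :> K.
Proof. by case: k. Qed.

Lemma ofRD r s : ofR k (r + s) = ofR k r + ofR k s :> K.
Proof. by case: k => //=; apply/eqP; rewrite eq_complex /= addr0 !eqxx. Qed.

Lemma ofRM r s : ofR k (r * s) = ofR k r * ofR k s :> K.
Proof.
case: k => //=; apply/eqP; rewrite eq_complex /=.
by rewrite !mul0r mulr0 subr0 addr0 !eqxx.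
Qed.

Lemma toRZ r a : toR (ofR k r * a) = r * toR a.
Proof. by case: k a => // -[a b] /=; rewrite mul0r subr0. Qed.

Lemma ofR_lt r s : (ofR k r < ofR k s :> K) = (r < s).
Proof. by case: k => //=; rewrite ltcE /= eqxx. Qed.

Lemma normr_ofR (X : normedZmodType K) (x : X) : `|x| = ofR k (rnorm x).
Proof.
rewrite /rnorm; move: (normr_ge0 x); move: `|x| => {x} a.
by case: k a => // -[a b]; rewrite lecE /= => /andP[/eqP-> _].
Qed.

Lemma rnorm0 (X : normedZmodType K) : rnorm (0 : X) = 0.
Proof. by rewrite /rnorm normr0 toR0. Qed.

Lemma rnormN (X : normedZmodType K) (x : X) : rnorm (- x) = rnorm x.
Proof. by rewrite /rnorm normrN. Qed.

Lemma rnorm0_eq0 (X : normedZmodType K) (x : X) : rnorm x = 0 -> x = 0.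
Proof. by move=> x0; apply: normr0_eq0; rewrite normr_ofR x0 ofR0. Qed.

Lemma rnormM a b : rnorm (a * b) = rnorm a * rnorm b.
Proof. exact: (@rnormZ R k K^o a b). Qed.

Lemma rnorm_ofR r : 0 <= r -> rnorm (ofR k r : K) = r.
Proof.
rewrite /rnorm; case: k => r0 /=; first by rewrite ger0_norm.
by rewrite expr0n addr0 sqrtr_sqr ger0_norm.
Qed.

Lemma toR_le_rnorm a : toR a <= rnorm a.
Proof.
rewrite /rnorm; case: k a => [a|[a b]] /=; first exact: ler_norm.
apply: le_trans (ler_norm _) _.
by rewrite -sqrtr_sqr ler_wsqrtr// lerDl sqr_ge0.
Qed.

Lemma rnorm_rotation a : exists2 b, rnorm b = 1 & b * a = ofR k (rnorm a).
Proof.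
have [->|a0] := eqVneq a 0.
  exists 1; last by rewrite mulr0 rnorm0 ofR0.
  by rewrite -ofR1 rnorm_ofR.
have ra0 : 0 < rnorm a.
  by rewrite lt_neqAle rnorm_ge0 andbT eq_sym;
    apply: contra_neq a0 => /rnorm0_eq0.
exists (ofR k (rnorm a) * a^-1); last by rewrite mulfVK.
apply: (mulIf (lt0r_neq0 ra0)).
by rewrite -rnormM mulfVK// rnorm_ofR ?rnorm_ge0// mul1r.
Qed.

Lemma cvg_rnormP {T : Type} {F : set_system T} {FF : Filter F}
    (f : T -> K) (l : K) :
  (forall e : R, 0 < e -> \forall t \near F, rnorm (l - f t) < e) <->
  f @ F --> l.
Proof.
split=> [fl|/cvgrPdist_lt fl e e0].
  apply/cvgrPdist_lt => e e0.
  have eE : e = ofR k (rnorm e) by rewrite -normr_ofR gtr0_norm.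
  have : 0 < rnorm e by rewrite -(ofR_lt 0) ofR0 -eE.
  by move=> /fl; apply: filterS => t ft; rewrite normr_ofR eE ofR_lt.
have : 0 < ofR k e :> K by rewrite -ofR0 ofR_lt.
by move=> /fl; apply: filterS => t; rewrite normr_ofR ofR_lt.
Qed.

End Scalars.

Definition real_restriction (R : realType) (k : scalar_kind)
  (V : lmodType (scalars R k)) : Type := V.

Section RealRestriction.
Context {R : realType} {k : scalar_kind} (V : lmodType (scalars R k)).

HB.instance Definition _ := GRing.Zmodule.on (real_restriction V).

Let scale (r : R) (x : real_restriction V) : real_restriction V :=
  (ofR k r) *: (x : V).

Let scaleA r s x : scale r (scale s x) = scale (r * s) x.
Proof. by rewrite /scale scalerA ofRM. Qed.

Let scale1 : left_id 1 scale.
Proof. by move=> x; rewrite /scale ofR1 scale1r. Qed.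

Let scaleDr : right_distributive scale +%R.
Proof. by move=> r x y; rewrite /scale -scalerDr. Qed.

Let scaleDl x : {morph scale^~ x : r s / r + s}.
Proof. by move=> r s; rewrite /scale ofRD -scalerDl. Qed.

HB.instance Definition _ := GRing.Zmodule_isLmodule.Build R (real_restriction V)
  scaleA scale1 scaleDr scaleDl.

Lemma real_scaleE r (x : real_restriction V) :
  r *: x = (ofR k r) *: (x : V).
Proof. by []. Qed.

End RealRestriction.

Section HahnBanach.
Context {R : realType} {k : scalar_kind}.
Notation K := (scalars R k).

Lemma is_scalarN (V : lmodType K) (h : V -> K) x : scalar h -> h (- x) = - h x.
Proof.
move=> hl; have h0 : h 0 = 0.
  by have := hl (-1) 0 0; rewrite scaler0 addr0 mulN1r addNr.
by have := hl (-1) x 0; rewrite addr0 scaleN1r mulN1r h0 addr0.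
Qed.

Lemma is_scalar0 (V : lmodType K) (h : V -> K) : scalar h -> h 0 = 0.
Proof.
by move=> hl; have := hl (-1) 0 0; rewrite scaler0 addr0 mulN1r addNr.
Qed.

Lemma is_scalarZ (V : lmodType K) (h : V -> K) a x :
  scalar h -> h (a *: x) = a * h x.
Proof. by move=> hl; have := hl a x 0; rewrite is_scalar0// !addr0. Qed.

Lemma is_scalarD (V : lmodType K) (h : V -> K) x y :
  scalar h -> h (x + y) = h x + h y.
Proof. by move=> hl; have := hl 1 x y; rewrite scale1r mul1r. Qed.

Lemma scalar_toR_inj (V : lmodType K) (g h : V -> K) : scalar g -> scalar h ->
  (forall x, toR (g x) = toR (h x)) -> g = h.
Proof.
move=> lg lh gh; apply/funext => x.
have [b b1 bE] := rnorm_rotation (g x - h x).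
apply/eqP; rewrite -subr_eq0; apply/eqP/rnorm0_eq0.
rewrite -[LHS](@toR_ofR R k) -bE mulrBr -!is_scalarZ//.
by rewrite toRD gh -toRD addrN toR0.
Qed.

End HahnBanach.

Lemma scalar_of_real_part (R : realType) (k : scalar_kind)
    (V : lmodType (scalars R k)) (h0 : real_restriction V -> R) :
  scalar h0 -> exists2 h : V -> scalars R k, scalar h & forall x, toR (h x) = h0 x.
Proof.
case: k V h0 => V h0 lh0; first by exists h0.
pose h0' : V -> R := h0.
have hD x y : h0' (x + y) = h0' x + h0' y.
  by have := lh0 1 x y; rewrite scale1r mul1r.
have h00 : h0' 0 = 0 by apply: (addrI (h0' 0)); rewrite -hD !addr0.
have hZ (r : R) (x : V) : h0' ((ofR ComplexScalars r : R[i]) *: x) = r * h0' x.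
  by have := lh0 r x 0; rewrite [h0 0]h00 !addr0.
have hN x : h0' (- x) = - h0' x.
  by apply/eqP; rewrite -addr_eq0 -hD addNr h00.
pose i : R[i] := Complex 0 1.
exists (fun x : V => Complex (h0' x) (- h0' (i *: x)) : R[i]) => // -[a b] x y.
have abE : Complex a b = ofR ComplexScalars a + ofR ComplexScalars b * i :> R[i].
  by apply/eqP; rewrite eq_complex /=; apply/andP; split; apply/eqP; ring.
have iab : i * Complex a b =
    ofR ComplexScalars a * i - ofR ComplexScalars b :> R[i].
  by apply/eqP; rewrite eq_complex /=; apply/andP; split; apply/eqP; ring.
have -> : h0' (Complex a b *: x + y) = a * h0' x + b * h0' (i *: x) + h0' y.
  by rewrite hD abE scalerDl hD hZ -scalerA hZ.
have -> : h0' (i *: (Complex a b *: x + y)) =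
    a * h0' (i *: x) - b * h0' x + h0' (i *: y).
  by rewrite scalerDr hD scalerA iab scalerBl hD hN hZ -scalerA hZ.
by apply/eqP; rewrite eq_complex /=; apply/andP; split; apply/eqP; ring.
Qed.

Lemma hahn_banach (R : realType) (k : scalar_kind)
    (U V : lmodType (scalars R k)) (Phi : U -> V) (g : U -> scalars R k)
    (p : V -> R) :
    is_seminorm p -> linear Phi -> scalar g ->
    (forall u, rnorm (g u) <= p (Phi u)) ->
  exists h : V -> scalars R k,
    [/\ scalar h, forall x, rnorm (h x) <= p x & forall u, h (Phi u) = g u].
Proof.
move=> [p0 pD pZ] lPhi lg gp.
have [||||h0 [lh0 h0p h0g]] := @real_hahn_banach R (real_restriction V)
    (real_restriction U) Phi (fun u => toR (g u)) p.
- split=> // t x t0; rewrite real_scaleE pZ rnorm_ofR//.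
- by move=> r x y; rewrite real_scaleE lPhi.
- by move=> r x y; rewrite real_scaleE lg toRD toRZ.
- by move=> u; apply: le_trans (gp u); exact: toR_le_rnorm.
have [h lh hE] := scalar_of_real_part lh0.
exists h; split=> // [x|u].
  have [b b1 bE] := rnorm_rotation (h x).
  rewrite -[leLHS](@toR_ofR R k) -bE -is_scalarZ// hE.
  by apply: le_trans (h0p _) _; rewrite pZ b1 mul1r.
suff /(congr1 (@^~ u)) : h \o Phi = g by [].
apply: scalar_toR_inj => // [a x y|x]; first by rewrite /= lPhi lh.
by rewrite /= hE h0g.
Qed.

(** * Functionals on bounded sequences *)

Section Seminorms.
Context {R : realType} {k : scalar_kind}.
Notation K := (scalars R k).

Lemma is_seminorm_le (V : lmodType K) (p : V -> R) : (forall x, 0 <= p x) ->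
  (forall x y, p (x + y) <= p x + p y) ->
  (forall (a : K) x, p (a *: x) <= rnorm a * p x) -> is_seminorm p.
Proof.
move=> p0 pD pZ; split=> // a x; apply/eqP; rewrite eq_le pZ/=.
have [->|a0] := eqVneq a 0; first by rewrite rnorm0 mul0r.
have ra0 : rnorm a != 0 by apply: contra_neq a0 => /rnorm0_eq0.
have : p x <= rnorm a^-1 * p (a *: x).
  by apply: le_trans (pZ _ _); rewrite scalerA mulVf// scale1r.
move=> /(ler_wpM2l (rnorm_ge0 a)); rewrite mulrA -rnormM mulfV//.
by rewrite -(ofR1 (k := k)) rnorm_ofR// mul1r.
Qed.

Lemma bounded_scalar_continuous (X : normedModType K) (u : X -> K) (C : R) :
  scalar u -> (forall z, rnorm (u z) <= C * rnorm z) -> continuous u.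
Proof.
move=> lu uC x; apply/cvg_rnormP => e e0.
pose D := Num.max C 0 + 1.
have D0 : 0 < D by rewrite ltr_pwDr// le_max lexx orbT.
have d0 : 0 < ofR k (e / D) :> K by rewrite -(ofR0 (k := k)) ofR_lt divr_gt0.
have xx : (fun t : X => t) @ x --> x by exact: cvg_id.
move/cvgrPdist_lt : xx => /(_ _ d0); apply: filterS => t /=.
rewrite normr_ofR ofR_lt ltr_pdivlMr// mulrC; apply: le_lt_trans.
rewrite -(is_scalarN t lu) -is_scalarD//; apply: le_trans (uC _) _.
apply: ler_wpM2r; first exact: rnorm_ge0.
by apply: le_trans (_ : Num.max C 0 <= _); rewrite ?le_max ?lexx// lerDl.
Qed.

End Seminorms.

Section BoundedSequences.
Context {R : realType} {k : scalar_kind}.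
Notation K := (scalars R k).
Context {F : normedModType K}.

Definition bounded_seq_pred : {pred nat -> F} :=
  [pred x | `[< exists M : R, forall n, rnorm (x n) <= M >]].

Lemma bounded_seq_closed : subsemimod_closed bounded_seq_pred.
Proof.
apply: GRing.submod_closed_semi; split.
  by apply/asboolP; exists 0 => n; rewrite rnorm0.
move=> a x y /asboolP[M xM] /asboolP[N yN]; apply/asboolP.
exists (rnorm a * M + N) => n; apply: le_trans (ler_rnormD _ _) _.
by rewrite lerD// rnormZ ler_wpM2l ?rnorm_ge0.
Qed.

HB.instance Definition _ :=
  GRing.isSubSemiModClosed.Build K (nat -> F) bounded_seq_pred bounded_seq_closed.

Definition bounded_seq := submod bounded_seq_pred.
Implicit Types (x y : bounded_seq).

Definition sup_norm x : R := sup (range (fun n => rnorm (val x n))).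

Lemma le_sup_norm x n : rnorm (val x n) <= sup_norm x.
Proof.
apply: ub_le_sup; last by exists n.
have /asboolP[M xM] := valP x.
by exists M => _ [m _ <-].
Qed.

Lemma sup_norm_le x M : (forall n, rnorm (val x n) <= M) -> sup_norm x <= M.
Proof. by move=> xM; apply: ge_sup => [|_ [n _ <-]//];
  exists (rnorm (val x 0)), 0. Qed.

Lemma sup_norm_seminorm : is_seminorm sup_norm.
Proof.
apply: is_seminorm_le => [x|x y|a x].
- by apply: le_trans (le_sup_norm x 0); exact: rnorm_ge0.
- apply: sup_norm_le => n; apply: le_trans (ler_rnormD _ _) _.
  by rewrite lerD// le_sup_norm.
- apply: sup_norm_le => n.
  by rewrite [val _ _]/= rnormZ ler_wpM2l ?rnorm_ge0// le_sup_norm.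
Qed.

Lemma single_subproof (n : nat) (z : F) :
  (fun m => if m == n then z else 0) \in bounded_seq_pred.
Proof.
apply/asboolP; exists (rnorm z) => m; case: ifP => // _.
by rewrite rnorm0 rnorm_ge0.
Qed.

Definition single n z : bounded_seq :=
  exist (fun s => s \in bounded_seq_pred) _ (single_subproof n z).

Lemma val_sum_single (z : nat -> F) N m :
  val (\sum_(0 <= n < N) single n (z n)) m = if (m < N)%N then z m else 0.
Proof.
elim: N => [|N IH]; first by rewrite big_nil.
rewrite big_nat_recr//=.
rewrite [LHS](_ : _ = val (\sum_(0 <= n < N) single n (z n)) m
                      + (if m == N then z N else 0))//.
by rewrite IH ltnS; case: ltngtP => [_|_|->]; rewrite ?addr0 ?add0r.
Qed.

Context (h : bounded_seq -> K) (C : R).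
Hypotheses (lh : scalar h) (C0 : 0 <= C).
Hypothesis hC : forall x, rnorm (h x) <= C * sup_norm x.

Lemma scalar_sum_single (z : nat -> F) N :
  h (\sum_(0 <= n < N) single n (z n)) = \sum_(0 <= n < N) h (single n (z n)).
Proof.
elim: N => [|N IH]; first by rewrite !big_nil is_scalar0.
by rewrite !big_nat_recr//= is_scalarD// IH.
Qed.

Lemma scalar_single n : scalar (h \o single n).
Proof.
move=> a z w /=; rewrite -lh; congr h; apply: val_inj; apply/funext => m /=.
rewrite [RHS](_ : _ = a *: (if m == n then z else 0) + (if m == n then w else 0))//.
by case: ifP; rewrite // scaler0 addr0.
Qed.

Lemma rnorm_single_le n z : rnorm (h (single n z)) <= C * rnorm z.
Proof.
apply: le_trans (hC _) _; apply: ler_wpM2l => //; apply: sup_norm_le => m /=.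
by case: ifP => // _; rewrite rnorm0 rnorm_ge0.
Qed.

Lemma sum_rnorm_single_le (z : nat -> F) (M : R) N :
  (forall n, rnorm (z n) <= M) ->
  \sum_(0 <= n < N) rnorm (h (single n (z n))) <= C * M.
Proof.
move=> zM.
have /boolp.choice[b bE] n : exists b : K, rnorm b = 1 /\
    b * h (single n (z n)) = ofR k (rnorm (h (single n (z n)))).
  by have [b b1 bE] := rnorm_rotation (h (single n (z n))); exists b.
have hE : h (\sum_(0 <= n < N) single n (b n *: z n)) =
    ofR k (\sum_(0 <= n < N) rnorm (h (single n (z n)))).
  rewrite scalar_sum_single; elim: N => [|N IH]; first by rewrite !big_nil ofR0.
  rewrite !big_nat_recr//= IH ofRD; congr (_ + _); have [_ <-] := bE N.
  exact: (is_scalarZ (b N) (z N) (@scalar_single N)).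
rewrite -[leLHS](@rnorm_ofR R k); last by apply: sumr_ge0 => n _;
  exact: rnorm_ge0.
rewrite -hE; apply: le_trans (hC _) _; apply: ler_wpM2l => //.
apply: sup_norm_le => m; rewrite val_sum_single; case: ifP => _.
  by have [b1 _] := bE m; rewrite rnormZ b1 mul1r.
by rewrite rnorm0; apply: le_trans (zM m); exact: rnorm_ge0.
Qed.

Lemma cvg_series_single x : (fun n => rnorm (val x n)) @ \oo --> (0 : R) ->
  series (fun n => h (single n (val x n))) @ \oo --> h x.
Proof.
move=> x0; apply/cvg_rnormP => e e0.
have d0 : 0 < e / (C + 1) by rewrite divr_gt0// ltr_wpDl.
have [N0 _ hN0] := cvgr0_norm_lt _ x0 _ d0.
exists N0 => // N /= N0N;
  rewrite seriesEnat /= -scalar_sum_single -is_scalarN// -is_scalarD//.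
apply: le_lt_trans (hC _) _.
apply: (@le_lt_trans _ _ (C * (e / (C + 1)))); last first.
  rewrite mulrCA gtr_pMr// ltr_pdivrMr ?ltr_wpDl//.
  by rewrite mul1r ltrDl.
apply: ler_wpM2l => //; apply: sup_norm_le => m.
rewrite [val _ _](_ : _ = val x m - val (\sum_(0 <= n < N) single n (val x n)) m)//.
rewrite val_sum_single; case: ltnP => [_|Nm]; first by rewrite subrr rnorm0 ltW.
have /= := hN0 m (leq_trans N0N Nm).
by rewrite subr0 ger0_norm ?rnorm_ge0// => /ltW.
Qed.

End BoundedSequences.

Arguments bounded_seq {R k} F.

(** * Summable sequences of functionals *)

Section EllOne.
Context {R : realType}.

Lemma sum_ereal_sup_le (T : Type) (B : set T) (phi : nat -> T -> R) N (C : R) :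
    B !=set0 -> (forall n z, 0 <= phi n z) ->
    (forall z : nat -> T, (forall n, B (z n)) ->
      \sum_(0 <= n < N) phi n (z n) <= C) ->
  (\sum_(0 <= n < N) ereal_sup [set (phi n z)%:E | z in B] <= C%:E)%E.
Proof.
move=> [z0 Bz0] phi0; elim: N C => [|N IH] C phiC.
  by have := phiC (fun=> z0) (fun=> Bz0); rewrite !big_nil lee_fin.
rewrite big_nat_recr//=; set S := (X in (X + _)%E).
have SC w : B w -> (S <= (C - phi N w)%:E)%E.
  move=> Bw; apply: IH => z Bz.
  have := phiC (fun n => if n == N then w else z n);
    rewrite big_nat_recr//= eqxx.
  rewrite lerBrDr => zC; apply: le_trans (zC _); last by move=> n; case: ifP.
  rewrite lerD2r le_eqVlt; apply/orP; left; apply/eqP.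
  by apply: eq_big_nat => n /andP[_ nN]; rewrite ltn_eqF.
have S0 : (0 <= S)%E.
  apply: sume_ge0 => n _; apply: le_trans (_ : (phi n z0)%:E <= _)%E.
    by rewrite lee_fin.
  by apply: ereal_sup_ubound; exists z0.
have Sfin : S \is a fin_num
  by rewrite ge0_fin_numE// (le_lt_trans (SC _ Bz0))// ltry.
rewrite -leeBrDl//; apply: ge_ereal_sup => _ [w Bw <-].
by rewrite leeBrDl// -leeBrDr//; apply: le_trans (SC _ Bw) _; rewrite EFinB.
Qed.

(* With the tails [r n] of the series, [a = sqrt r] and                      *)
(* [c n = 2 (sqrt (r n) - sqrt (r n.+1))], which telescopes.                 *)
Lemma summable_null_factor (w : nat -> R) (M : R) : (forall n, 0 <= w n) ->
    (forall N, \sum_(0 <= n < N) w n <= M) ->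
  exists a c : nat -> R, exists C : R,
    [/\ forall n, 0 <= a n, a @ \oo --> 0, forall n, 0 <= c n,
        forall N, \sum_(0 <= n < N) c n <= C & forall n, w n <= c n * a n].
Proof.
move=> w0 wM; pose S n := \sum_(0 <= i < n) w i.
have SS n : S n.+1 = S n + w n by rewrite /S big_nat_recr.
have Sincr : nondecreasing_seq S.
  by apply/nondecreasing_seqP => n; rewrite SS lerDl.
have Sub : has_ubound (range S) by exists M => _ [n _ <-]; exact: wM.
pose L := sup (range S); have SL : S @ \oo --> L by exact: nondecreasing_cvgn.
pose r n := L - S n.
have r0 n : 0 <= r n by rewrite subr_ge0; apply: ub_le_sup => //; exists n.
have rw n : w n = r n - r n.+1 by rewrite /r SS; ring.
have rdec n : r n.+1 <= r n by rewrite -subr_ge0 -rw.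
pose a n := Num.sqrt (r n).
have a0 n : 0 <= a n by exact: sqrtr_ge0.
have adec n : a n.+1 <= a n by rewrite ler_wsqrtr.
have aa n : r n = a n * a n by rewrite -expr2 sqr_sqrtr.
exists a, (fun n => 2 * (a n - a n.+1)), (2 * a 0%N); split=> //.
- apply/cvgrPdist_lt => e e0; have e20 : 0 < e ^+ 2 by rewrite exprn_gt0.
  move/cvgrPdist_lt : SL => /(_ _ e20); apply: filterS => n.
  rewrite ger0_norm ?r0// => rne; rewrite sub0r normrN ger0_norm//.
  by rewrite -[ltRHS]gtr0_norm// -sqrtr_sqr ltr_sqrt.
- by move=> n; rewrite mulr_ge0// subr_ge0.
- move=> N; rewrite -mulr_sumr ler_wpM2l// -lerN2 -sumrN.
  under eq_bigr do rewrite opprB.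
  by rewrite telescope_sumr// lerBrDr addNr.
- move=> n; rewrite rw !aa; have := adec n; have := a0 n; have := a0 n.+1.
  by nra.
Qed.

Context {k : scalar_kind} {X : normedModType (scalars R k)}.
Implicit Types (l : nat -> X -> scalars R k) (u : X -> scalars R k).

Lemma ell1_dual_intro l (C : R) : (forall n, top_dual (l n)) ->
    (forall N (z : nat -> X), (forall n, rnorm (z n) <= 1) ->
      \sum_(0 <= n < N) rnorm (l n (z n)) <= C) ->
  ell1_dual l.
Proof.
move=> lt lC; split=> //; apply: le_lt_trans (ltry C).
apply: lime_le.
  apply: is_cvg_nneseries => n _ _.
  apply: le_trans (_ : (rnorm (l n 0))%:E <= _)%E;
    first by rewrite lee_fin rnorm_ge0.
  by apply: ereal_sup_ubound; exists 0 => //=; rewrite rnorm0.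
apply: nearW => N; apply: sum_ereal_sup_le => //.
- by exists 0; rewrite /= rnorm0.
- by move=> n z; exact: rnorm_ge0.
- exact: lC.
Qed.

Lemma dual_norm_ge0 u : (0 <= dual_norm u)%E.
Proof.
apply: le_trans (_ : (rnorm (u 0))%:E <= _)%E;
  first by rewrite lee_fin rnorm_ge0.
by apply: ereal_sup_ubound; exists 0 => //=; rewrite rnorm0.
Qed.

Lemma rnorm_le_dual_norm u z : scalar u -> (dual_norm u < +oo)%E ->
  rnorm (u z) <= fine (dual_norm u) * rnorm z.
Proof.
move=> lu ufin; have [->|z0] := eqVneq z 0;
  first by rewrite is_scalar0// !rnorm0 mulr0.
have rz0 : 0 < rnorm z.
  by rewrite lt_neqAle rnorm_ge0 andbT eq_sym;
    apply: contra_neq z0 => /rnorm0_eq0.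
have rVz : rnorm (ofR k (rnorm z)^-1) = (rnorm z)^-1.
  by rewrite rnorm_ofR// invr_ge0 ltW.
rewrite -ler_pdivrMr// mulrC -rVz -rnormM -is_scalarZ// -lee_fin fineK;
  last first.
  by rewrite ge0_fin_numE// dual_norm_ge0.
apply: ereal_sup_ubound; exists (ofR k (rnorm z)^-1 *: z) => //=.
by rewrite rnormZ rVz mulVf// gt_eqF.
Qed.

Lemma ell1_dual_weights l : ell1_dual l ->
  exists w : nat -> R, exists M : R, [/\ forall n, 0 <= w n,
    forall N, \sum_(0 <= n < N) w n <= M &
    forall n z, rnorm (l n z) <= w n * rnorm z].
Proof.
move=> [lt lfin]; pose S := (\sum_(0 <= n <oo) dual_norm (l n))%E.
have l0 n : (0 <= n)%N -> true -> (0 <= dual_norm (l n))%E.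
  by move=> _ _; exact: dual_norm_ge0.
have S0 : (0 <= S)%E by exact: nneseries_ge0.
have lS N : (\sum_(0 <= n < N) dual_norm (l n) <= S)%E
  by exact: nneseries_lim_ge.
have lnfin n : (dual_norm (l n) < +oo)%E.
  apply: le_lt_trans lfin; apply: le_trans (lS n.+1).
  by rewrite big_nat_recr//= leeDr// sume_ge0// => i _; exact: dual_norm_ge0.
have lnE n : dual_norm (l n) = (fine (dual_norm (l n)))%:E.
  by rewrite fineK// ge0_fin_numE// dual_norm_ge0.
exists (fun n => fine (dual_norm (l n))), (fine S); split.
- by move=> n; rewrite fine_ge0// dual_norm_ge0.
- move=> N; rewrite -lee_fin fineK ?ge0_fin_numE//; apply: le_trans (lS N).
  by rewrite -sumEFin le_eqVlt; apply/orP; left; apply/eqP; apply: eq_bigr.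
- by move=> n z; apply: rnorm_le_dual_norm => //; have [] := lt n.
Qed.

End EllOne.

(** * Topologies generated by directed families of seminorms *)

Section SeminormedTopology.
Context {R : realType} {k : scalar_kind} {V : lmodType (scalars R k)}.
Notation K := (scalars R k).

Lemma seminorm0 (p : V -> R) : is_seminorm p -> p 0 = 0.
Proof. by move=> [_ _ pZ]; have := pZ 0 0; rewrite scaler0 rnorm0 mul0r. Qed.

Context (P : set (V -> R)).
Hypotheses (Psemi : forall p, P p -> is_seminorm p) (P0 : P !=set0).
Hypothesis Pdirected : forall p q, P p -> P q ->
  exists2 r, P r & forall x, p x <= r x /\ q x <= r x.

Lemma seminormed_top_nbhs0 (A : set (seminormed_top P)) :
  nbhs (0 : seminormed_top P) A ->
  exists2 p, P p & exists2 e : R, 0 < e & [set y : V | p y < e] `<=` A.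
Proof.
pose D := [set pe : (V -> R) * R | P pe.1 /\ 0 < pe.2].
pose B (pe : (V -> R) * R) : set V := [set y | pe.1 y < pe.2].
have FF : Filter (filter_from D B).
  apply: filter_from_filter.
    by have [p Pp] := P0; exists (p, 1); split => /=.
  move=> [p e] [q d] [/= Pp e0] [/= Pq d0]; have [r Pr pqr] := Pdirected Pp Pq.
  exists (r, Num.min e d); first by split=> //=; rewrite lt_min e0.
  move=> y; rewrite /B /= lt_min => /andP[re rd]; have [pr qr] := pqr y.
  by split; [exact: le_lt_trans pr re|exact: le_lt_trans qr rd].
suff h : nbhs (0 : seminormed_top P) A -> filter_from D B A.
  by move=> /h [[p e] [Pp e0] peA]; exists p => //; exists e.
rewrite (@nbhsE (seminormed_top P)) => -[_ [[S sS <-] [U OU U0] sUA]].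
apply: (@filterS _ _ FF _ _ sUA); apply: (@filterS _ _ FF U).
  by move=> y Uy; exists U.
have /sS [/= N sN NU] := OU; rewrite -NU.
apply: filter_bigI => W NW.
have W0 : W (0 : V) by move: U0; rewrite -NU => /(_ _ NW).
have /sN := NW; rewrite inE => -[p [x [e [Pp e0 WE]]]].
have [_ pD _] := Psemi Pp.
exists (p, e - p (- x)); rewrite /D /B /=.
  by split => //; move: W0; rewrite WE /= sub0r subr_gt0.
by move=> y /= ype; rewrite WE /=; apply: le_lt_trans (pD _ _) _;
  rewrite -ltrBrDr.
Qed.

Lemma seminormed_top_ball (p : V -> R) (x : seminormed_top P) (e : R) :
  P p -> 0 < e -> nbhs x [set y : V | p (y - x) < e].
Proof.
move=> Pp e0; rewrite (@nbhsE (seminormed_top P)).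
exists [set y : V | p (y - x) < e] => //; split; last first.
  by rewrite /= subrr seminorm0//; exact: Psemi.
exists [set [set y : V | p (y - x) < e]]; last by rewrite bigcup_set1.
by move=> _ ->; apply: finI_from1; exists p, x, e.
Qed.

Lemma seminormed_top_continuousP (u : V -> K) : scalar u ->
  continuous (u : seminormed_top P -> K) <->
  exists2 p, P p & exists2 C : R, 0 <= C & forall x, rnorm (u x) <= C * p x.
Proof.
move=> lu; split=> [cu|[p Pp [C C0 uC]] x]; last first.
  apply/(cvg_rnormP (FF := @nbhs_filter (seminormed_top P) x)) => e e0.
  have d0 : 0 < e / (C + 1) by rewrite divr_gt0// ltr_wpDl.
  have [p0 _ pZ] := Psemi Pp.
  apply: (@filterS _ _ (@nbhs_filter (seminormed_top P) x) _ _ _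
    (seminormed_top_ball x Pp d0)) => y /= ype.
  rewrite -rnormN opprB -(is_scalarN x lu) -is_scalarD//.
  apply: le_lt_trans (uC _) _.
  apply: (@le_lt_trans _ _ ((C + 1) * p (y - x))).
    by rewrite ler_wpM2r// lerDl.
  by rewrite mulrC -ltr_pdivlMr// ltr_wpDl.
have /(cvg_rnormP (FF := @nbhs_filter (seminormed_top P) 0))/(_ _ ltr01)/seminormed_top_nbhs0 [p Pp [e e0 pe]] := cu 0.
exists p => //; exists e^-1; first by rewrite invr_ge0 ltW.
have [p0 _ pZ] := Psemi Pp.
move=> x; rewrite ler_pdivlMl//; apply/ler_addgt0Pr => d d0.
have pd0 : 0 < p x + d by rewrite ltr_wpDl.
have ed0 : 0 <= e / (p x + d) by rewrite divr_ge0 ?ltW.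
have /pe /= : p (ofR k (e / (p x + d)) *: x) < e.
  by rewrite pZ rnorm_ofR// mulrAC ltr_pdivrMr// ltr_pM2l// ltrDl.
rewrite is_scalar0// sub0r rnormN is_scalarZ// rnormM rnorm_ofR//.
by rewrite mulrAC ltr_pdivrMr// mul1r => /ltW.
Qed.

End SeminormedTopology.

(** * The submixed topology *)

Lemma null_seq_bounded (R : realType) (a : nat -> R) : (forall n, 0 <= a n) ->
  a @ \oo --> 0 -> exists2 B : R, 0 <= B & forall n, a n <= B.
Proof.
move=> a0 /cvgr0_norm_lt/(_ _ ltr01)[N _ aN].
have s0 M : 0 <= \sum_(0 <= i < M) a i by rewrite sumr_ge0.
exists (1 + \sum_(0 <= i < N) a i) => [|n]; first by rewrite addr_ge0.
have [nN|Nn] := ltnP n N.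
  rewrite (bigD1_seq n)/= ?mem_index_iota ?iota_uniq//.
  by rewrite addrCA lerDl addr_ge0// sumr_ge0.
have /= := aN n Nn; rewrite ger0_norm// => /ltW an.
by apply: le_trans an _; rewrite lerDl.
Qed.

(* A bijection of [nat] with pairs [(n, i)] lists the [i]-th point of [S n]. *)
Lemma flatten_finite_sets (R : realType) (L : Type) (x0 : L)
    (S : nat -> set L) (a : nat -> R) :
    (forall n, finite_set (S n)) -> (forall n, 0 <= a n) -> a @ \oo --> 0 ->
  exists (x : nat -> L) (b : nat -> R),
    [/\ forall j, 0 <= b j, b @ \oo --> 0 &
        forall n y, S n y -> exists2 j, x j = y & b j = a n].
Proof.
move=> Sfin a0 acvg.
have /boolp.choice[s sE] n : exists s : seq {classic L}, S n = [set` s].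
  by apply/finite_seqP; exact: Sfin.
pose x (j : nat) : L :=
  if pickle_inv j is Some (n, i) then nth (x0 : {classic L}) (s n) i else x0.
pose b (j : nat) : R :=
  if pickle_inv j is Some (n, i) then if (i < size (s n))%N then a n else 0 else 0.
exists x, b; split.
- by move=> j; rewrite /b; case: pickle_inv => // -[n i]; case: ifP.
- apply/cvgr0Pnorm_lt => e e0.
  have [N _ aN] := cvgr0_norm_lt _ acvg _ e0.
  exists (\sum_(0 <= n < N) \sum_(0 <= i < size (s n)) (pickle (n, i)).+1)%N => //.
  move=> j /= jN; rewrite /b.
  case uj: (pickle_inv j) => [[n i]|]; last by rewrite normr0.
  case: ifP => [si|_]; last by rewrite normr0.
  apply: aN => /=; rewrite leqNgt; apply/negP => nN.
  have jE : pickle (n, i) = j.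
    by have := @pickle_invK (nat * nat)%type j; rewrite uj.
  move: jN; rewrite (bigD1_seq n)/= ?mem_index_iota ?iota_uniq//.
  rewrite (bigD1_seq i)/= ?mem_index_iota ?iota_uniq//.
  by rewrite jE -addnA addSn ltnNge leq_addr.
- move=> n y; rewrite sE /= => ys.
  exists (pickle (n, index (y : {classic L}) (s n))).
    by rewrite /x pickleK_inv nth_index.
  by rewrite /b pickleK_inv index_mem ys.
Qed.

Section Weighted.
Context {R : realType} {k : scalar_kind} {Omega Lambda : Type}.
Context {v : Lambda -> {posnum R}} {E : normedModType (scalars R k)}.
Context {G : submodClosed (Omega -> E)} {q : seminorm (submod G)}.
Context {T : {linear submod G -> (Lambda -> E)}}.
Context (T0 : {linear submod G -> E}) (hq : forall f : submod G, q f = rnorm (T0 f)).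
Notation K := (scalars R k).
Notation Fv := (Fv v q T).
Notation qS := (qS v q T).
Implicit Types (f g : Fv) (S : set Lambda) (x : Lambda) (M : R).

Definition weighted_pair x f : l1_prod E E :=
  (T0 (val f), ofR k (v x)%:num *: T (val f) x).

Lemma weighted_pairP (x : Lambda) : linear (weighted_pair x).
Proof.
move=> a f g.
have vE : val (a *: f + g) = a *: val f + val g by rewrite linearP.
have TE : T (val (a *: f + g)) x = a *: T (val f) x + T (val g) x.
  by rewrite vE linearP.
have T0E : T0 (val (a *: f + g)) = a *: T0 (val f) + T0 (val g).
  by rewrite vE linearP.
by rewrite /weighted_pair TE T0E scalerDr scalerA mulrC -scalerA.
Qed.

Lemma rnorm_weighted_pair x f :
  rnorm (weighted_pair x f) = q (val f) + rnorm (T (val f) x) * (v x)%:num.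
Proof.
rewrite /rnorm [`|weighted_pair x f|](_ : _ = l1_prod_norm (weighted_pair x f))//.
rewrite /l1_prod_norm toRD /= hq; congr (_ + _).
by rewrite -[LHS]/(rnorm _) rnormZ rnorm_ofR// mulrC.
Qed.

Let supT S f := ereal_sup
  (0%:E |` [set (rnorm (T (val f) x) * (v x)%:num)%:E | x in S]).

Let supT_ge0 S f : (0 <= supT S f)%E.
Proof. by apply: ereal_sup_ubound; left. Qed.

Let qS_E S f : (qS S f)%:E = ((q (val f))%:E + supT S f)%E.
Proof.
rewrite /Defs.qS fineK//.
have : (ext_seminorm v q T S (val f) < +oo)%E.
  have /asboolP := valP f; move=> /ext_seminorm_ltyP[M fM].
  by apply/ext_seminorm_ltyP; exists M => x _; exact: fM.
rewrite ge0_fin_numE// adde_ge0// ?supT_ge0// lee_fin.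
by have [q0 _ _] := seminormP q; exact: q0.
Qed.

Lemma seminorm_le_qS S f : q (val f) <= qS S f.
Proof. by rewrite -lee_fin qS_E leeDl. Qed.

Lemma le_qS S f x : S x -> rnorm (weighted_pair x f) <= qS S f.
Proof.
move=> Sx; rewrite rnorm_weighted_pair -lee_fin qS_E EFinD leeD2l//.
by apply: ereal_sup_ubound; right; exists x.
Qed.

Lemma qS_le S f M : q (val f) <= M ->
  (forall x, S x -> rnorm (weighted_pair x f) <= M) -> qS S f <= M.
Proof.
move=> qM xM; rewrite -lee_fin qS_E -leeBrDl// -EFinB.
apply: ge_ereal_sup => _ [->|[x Sx <-]]; first by rewrite lee_fin subr_ge0.
by rewrite lee_fin lerBrDl -rnorm_weighted_pair xM.
Qed.

Lemma qS_ge0 S f : 0 <= qS S f.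
Proof.
by apply: le_trans (seminorm_le_qS S f); have [q0 _ _] := seminormP q;
  exact: q0.
Qed.

Lemma qS_sub S S' f : S `<=` S' -> qS S f <= qS S' f.
Proof.
move=> SS'; apply: qS_le; first exact: seminorm_le_qS.
by move=> x /SS' Sx; exact: le_qS.
Qed.

Lemma qS_seminorm S : is_seminorm (qS S).
Proof.
have [_ qD qZ] := seminormP q.
apply: is_seminorm_le => [f|f g|a f].
- exact: qS_ge0.
- apply: qS_le => [|x Sx].
    by apply: le_trans (qD _ _) _; rewrite lerD// seminorm_le_qS.
  have /= := weighted_pairP x 1 f g; rewrite !scale1r => ->.
  by apply: le_trans (ler_rnormD _ _) _; rewrite lerD// le_qS.
- apply: qS_le => [|x Sx].
    by rewrite [q _]qZ ler_wpM2l ?rnorm_ge0// seminorm_le_qS.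
  have w0 : weighted_pair x 0 = 0.
    by have := weighted_pairP x (-1) 0 0; rewrite scaler0 addr0 scaleN1r addNr.
  have /= := weighted_pairP x a f 0; rewrite w0 !addr0 => ->.
  by rewrite rnormZ ler_wpM2l ?rnorm_ge0// le_qS.
Qed.

Section Submixed.
Context (S : nat -> set Lambda) (a : nat -> R).
Hypotheses (a0 : forall n, 0 <= a n) (acvg : a @ \oo --> 0).
Let p f := sup (range (fun n => qS (S n) f * a n)).

Lemma le_submixed n f : qS (S n) f * a n <= p f.
Proof.
have [B B0 aB] := null_seq_bounded a0 acvg.
apply: ub_le_sup; last by exists n.
exists (qS setT f * B) => _ [m _ <-].
by apply: ler_pM => //; [exact: qS_ge0|exact: qS_sub].
Qed.

Lemma submixed_le f M : (forall n, qS (S n) f * a n <= M) -> p f <= M.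
Proof.
by move=> pM; apply: ge_sup => [|_ [n _ <-]//]; exists (qS (S 0) f * a 0), 0.
Qed.

Lemma submixed_seminorm : is_seminorm p.
Proof.
apply: is_seminorm_le => [f|f g|c f].
- by apply: le_trans (le_submixed 0 f); rewrite mulr_ge0// qS_ge0.
- apply: submixed_le => n; have [_ qD _] := qS_seminorm (S n).
  apply: (@le_trans _ _ ((qS (S n) f + qS (S n) g) * a n)).
    by rewrite ler_wpM2r.
  by rewrite mulrDl lerD// le_submixed.
- apply: submixed_le => n; have [_ _ ->] := qS_seminorm (S n).
  by rewrite -mulrA ler_wpM2l ?rnorm_ge0// le_submixed.
Qed.

End Submixed.

Lemma submixed_seminorms_directed (p p' : Fv -> R) :
    submixed_seminorms v q T p -> submixed_seminorms v q T p' ->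
  exists2 r, submixed_seminorms v q T r & forall f, p f <= r f /\ p' f <= r f.
Proof.
move=> [S [a [Sfin a0 acvg ->]]] [S' [a' [S'fin a'0 a'cvg ->]]].
pose U n := S n `|` S' n; pose c n := a n + a' n.
have c0 n : 0 <= c n by rewrite addr_ge0.
have ccvg : c @ \oo --> 0 by rewrite -[0]addr0; exact: cvgD.
exists (fun f => sup (range (fun n => qS (U n) f * c n))).
  exists U, c; split=> // n; rewrite finite_setU; split;
    [exact: Sfin|exact: S'fin].
move=> f; split; apply: submixed_le => n.
  apply: (le_trans _ (le_submixed U c0 ccvg n f)).
  apply: ler_pM; rewrite ?qS_ge0 ?lerDl//; by apply: qS_sub; left.
apply: (le_trans _ (le_submixed U c0 ccvg n f)).
apply: ler_pM; rewrite ?qS_ge0 ?lerDr//; by apply: qS_sub; right.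
Qed.

Lemma top_dual_submixedP (u : Fv -> K) : top_dual (V := submixed_Fv v q T) u <->
  scalar u /\ exists2 p, submixed_seminorms v q T p &
    exists2 C : R, 0 <= C & forall f, rnorm (u f) <= C * p f.
Proof.
have semi (p : Fv -> R) : submixed_seminorms v q T p -> is_seminorm p.
  by move=> [S [a [_ a0 acvg ->]]]; exact: submixed_seminorm.
have p0 : submixed_seminorms v q T !=set0.
  exists (fun f => sup (range (fun n : nat => qS set0 f * 0))).
  by exists (fun=> set0), (fun=> 0); split=> //; exact: cvg_cst.
have cP := seminormed_top_continuousP semi p0 submixed_seminorms_directed.
by split=> -[lu cu]; split=> //; apply/(cP _ lu).
Qed.

Lemma ell1_representation (x0 : Lambda) (S : nat -> set Lambda) (a : nat -> R)
    (u : Fv -> K) (C : R) :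
    (forall n, finite_set (S n)) -> (forall n, 0 <= a n) -> a @ \oo --> 0 ->
    scalar u -> 0 <= C ->
    (forall f, rnorm (u f) <= C * sup (range (fun n => qS (S n) f * a n))) ->
  exists (l : nat -> l1_prod E E -> K) (x : nat -> Lambda), ell1_dual l /\
    forall f, series (fun n => l n (weighted_pair (x n) f)) @ \oo --> u f.
Proof.
move=> Sfin a0 acvg lu C0 uC.
pose S' n := S n `|` [set x0].
have S'fin n : finite_set (S' n).
  by rewrite finite_setU; split; [exact: Sfin|exact: finite_set1].
have [x [b [b0 bcvg xb]]] := flatten_finite_sets x0 S'fin a0 acvg.
have [B B0 bB] := null_seq_bounded b0 bcvg.
pose phi f j := ofR k (b j) *: weighted_pair (x j) f.
have rphi f j : rnorm (phi f j) = b j * rnorm (weighted_pair (x j) f).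
  by rewrite rnormZ rnorm_ofR.
have phi_le f j : rnorm (phi f j) <= b j * qS setT f.
  by rewrite rphi ler_wpM2l// le_qS.
have phiP f : phi f \in bounded_seq_pred.
  apply/asboolP; exists (B * qS setT f) => j; apply: le_trans (phi_le f j) _.
  by rewrite ler_wpM2r// qS_ge0.
pose Phi f : bounded_seq (l1_prod E E) := exist (fun s => s \in bounded_seq_pred) _ (phiP f).
have lPhi : linear Phi.
  move=> c f g; apply: val_inj; apply/funext => j.
  rewrite linearP [LHS]/= /phi weighted_pairP scalerDr !scalerA mulrC -scalerA.
  by [].
have [N0 ND NZ] := @sup_norm_seminorm R k (l1_prod E E).
have seminormC : is_seminorm
    (fun s : bounded_seq (l1_prod E E) => C * sup_norm s).
  split=> [y|y z|c y]; first exact: mulr_ge0 C0 (N0 y).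
    by rewrite -mulrDr; exact: ler_wpM2l C0 _ _ (ND y z).
  by rewrite NZ mulrCA.
have uPhi f : rnorm (u f) <= C * sup_norm (Phi f).
  apply: le_trans (uC f) _; apply: ler_wpM2l => //; apply: submixed_le => n.
  have := a0 n; rewrite le_eqVlt => /predU1P[<-|an0]; first by rewrite mulr0.
  have wPhi y : S' n y -> rnorm (weighted_pair y f) <= sup_norm (Phi f) / a n.
    move=> /xb[j <- bj]; rewrite ler_pdivlMr// mulrC -bj -rphi.
    exact: (le_sup_norm (Phi f) j).
  rewrite -ler_pdivlMr//; apply: qS_le => [|y Sy]; last by apply: wPhi; left.
  apply: le_trans (seminorm_le_qS set0 f) _.
  apply: le_trans (_ : rnorm (weighted_pair x0 f) <= _); last by apply: wPhi;
    right.
  by apply: qS_le => //; rewrite rnorm_weighted_pair lerDl mulr_ge0// rnorm_ge0.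
have [h [lh hC hE]] := hahn_banach seminormC lPhi lu uPhi.
exists (fun n z => h (single n (ofR k (b n) *: z))), x; split.
  apply: (@ell1_dual_intro _ _ _ _ (C * B)) => [n|N z z1].
    have ll : scalar (fun z : l1_prod E E => h (single n (ofR k (b n) *: z))).
      move=> c z w; rewrite scalerDr scalerA mulrC -scalerA.
      exact: (scalar_single lh).
    split=> //; apply: (@bounded_scalar_continuous _ _ _ _ (C * b n)) => // z.
    apply: le_trans (rnorm_single_le C0 hC _ _) _.
    by rewrite rnormZ rnorm_ofR// mulrA.
  apply: (@sum_rnorm_single_le _ _ _ _ _ lh C0 hC (fun n => ofR k (b n) *: z n)).
  move=> n; rewrite rnormZ rnorm_ofR//.
  by rewrite -[leRHS]mulr1 ler_pM// rnorm_ge0.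
move=> f; rewrite -hE.
apply: (cvg_series_single lh C0 hC); apply/cvgr0Pnorm_lt => e e0.
have qS1 : 0 < qS setT f + 1 by rewrite ltr_wpDl// qS_ge0.
have [N _ bN] := cvgr0_norm_lt _ bcvg _ (divr_gt0 e0 qS1).
exists N => // j /bN /=; rewrite !ger0_norm ?rnorm_ge0// ltr_pdivlMr//.
apply: le_lt_trans; apply: le_trans (phi_le f j) _.
by rewrite ler_wpM2l// lerDl.
Qed.

Lemma ell1_series_bound (l : nat -> l1_prod E E -> K) (x : nat -> Lambda)
    (u : Fv -> K) : ell1_dual l ->
    (forall f, series (fun n => l n (weighted_pair (x n) f)) @ \oo --> u f) ->
  scalar u /\ exists2 p, submixed_seminorms v q T p &
    exists2 C : R, 0 <= C & forall f, rnorm (u f) <= C * p f.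
Proof.
move=> lell lu.
have llin n : scalar (l n) by have [lt _] := lell; have [] := lt n.
split.
  move=> c f g; apply: (cvg_unique (@norm_hausdorff _ _) (lu _)).
  have -> : series (fun n => l n (weighted_pair (x n) (c *: f + g))) =
      (fun N => c * series (fun n => l n (weighted_pair (x n) f)) N +
                series (fun n => l n (weighted_pair (x n) g)) N).
    apply/funext => N; rewrite !seriesEnat /= mulr_sumr -big_split/=.
    by apply: eq_bigr => n _; rewrite weighted_pairP llin.
  by apply: cvgD (lu g); apply: cvgMl_tmp; exact: lu.
have [w [M [w0 wM lw]]] := ell1_dual_weights lell.
have [a [c [C [a0 acvg c0 cC wca]]]] := summable_null_factor w0 wM.
pose S n := [set x n].
exists (fun f => sup (range (fun n => qS (S n) f * a n))).
  by exists S, a; split=> // n; exact: finite_set1.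
exists C; first by have := cC 0%N; rewrite big_nil.
move=> f; apply/ler_addgt0Pr => e e0; set p := sup _.
have /cvg_rnormP/(_ _ e0)[N _ uN] := lu f.
rewrite -[u f](subrK (series (fun n => l n (weighted_pair (x n) f)) N)).
rewrite addrC; apply: le_trans (ler_rnormD _ _) _.
apply: lerD; last by apply/ltW/uN => /=.
have p0 : 0 <= p.
  by apply: le_trans (le_submixed S a0 acvg 0 f); rewrite mulr_ge0// qS_ge0.
have sumle : rnorm (series (fun n => l n (weighted_pair (x n) f)) N) <=
    \sum_(0 <= n < N) c n * p.
  rewrite seriesEnat /=; elim: N {uN} => [|N IH];
    first by rewrite !big_nil rnorm0.
  rewrite !big_nat_recr//=; apply: le_trans (ler_rnormD _ _) _;
    apply: lerD => //.
  apply: le_trans (lw _ _) _.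
  apply: le_trans (ler_wpM2r (rnorm_ge0 _) (wca N)) _.
  rewrite -mulrA ler_wpM2l// mulrC; apply: le_trans (le_submixed S a0 acvg N f).
  by rewrite ler_wpM2r// le_qS.
by apply: le_trans sumle _; rewrite -mulr_suml ler_wpM2r.
Qed.

End Weighted.

Theorem theorem5p1 (R : realType) (k : scalar_kind) (Omega Lambda : Type)
    (hOmega : inhabited Omega) (hLambda : inhabited Lambda)
    (v : Lambda -> {posnum R}) (E : normedModType (scalars R k))
    (G : submodClosed (Omega -> E)) (q : seminorm (submod G))
    (T : {linear submod G -> (Lambda -> E)})
    (hnorm : is_norm (Fv_norm v q T))
    (T0 : {linear submod G -> E}) (hq : forall f : submod G, q f = rnorm (T0 f))
    (f' : Fv v q T -> scalars R k) :
  top_dual (V := submixed_Fv v q T) f' <->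
  exists (l : nat -> l1_prod E E -> scalars R k) (x : nat -> Lambda),
    ell1_dual l /\
    forall f : Fv v q T,
      series (fun n =>
        l n (T0 (val f), ofR k (v (x n))%:num *: T (val f) (x n))) @ \oo --> f' f.
Proof.
have [x0] := hLambda.
split=> [/(top_dual_submixedP hq)[lf' [_ [S [a [Sfin a0 acvg ->]]] [C C0 f'C]]]|].
  exact: (ell1_representation hq x0 Sfin a0 acvg lf' C0 f'C).
move=> [l [x [lell lf']]]; apply/(top_dual_submixedP hq).
exact: (ell1_series_bound hq lell lf').
Qed.
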